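(* Let $(I,\mathcal{A},\lambda)$ and $(J,\mathcal{B},\pi)$ be probability spaces. Let $\varphi:\mathcal{B}\to[0,\infty)$ be a submodular setfunction with $\varphi(\emptyset)=0$ that is uniformly continuous with respect to $\pi$. Let $F:I\times J\to\mathbb{R}$ be a bounded $\mathcal{A}\times\mathcal{B}$-measurable function, put $F_x(y)=F(x,y)$, and $g(y)=\int_I F(x,y)\,d\lambda(x)$. Then $x\mapsto\widehat\varphi(F_x)$ is an integrable function of $x$ (with respect to $\lambda$), and $$\widehat\varphi(g)\le\int_I\widehat\varphi(F_x)\,d\lambda(x).$$
   Context: $\varphi$ is submodular if $\varphi(X\cup Y)+\varphi(X\cap Y)\le\varphi(X)+\varphi(Y)$ for all $X,Y\in\mathcal{B}$. $\varphi$ is uniformly continuous with respect to $\pi$ if for every $\varepsilon>0$ there is $\delta>0$ such that $\pi(S\triangle T)<\delta$ ($S,T\in\mathcal{B}$) implies $|\varphi(S)-\varphi(T)|<\varepsilon$. For a bounded $\mathcal{B}$-measurable $f:J\to\mathbb{R}$ write $\{f\ge t\}=\{y\in J:f(y)\ge t\}$ and $\|f\|=\sup|f|$. The Choquet extension $\widehat\varphi$ is defined as follows: a setfunction has bounded variation if $\sum_{i=1}^n|\varphi(X_i)-\varphi(X_{i-1})|$ is bounded over chains $\emptyset=X_0\subseteq\dots\subseteq X_n=J$ in $\mathcal{B}$ (such $\varphi$ is a difference $\mu-\nu$ of increasing setfunctions vanishing at $\emptyset$, e.g. $\mu(S)=\sup\sum_i\max(0,\varphi(X_i)-\varphi(X_{i-1}))$,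 $\nu(S)=\sup\sum_i\max(0,\varphi(X_{i-1})-\varphi(X_i))$ over chains from $\emptyset$ to $S$); for increasing $\psi$ with $\psi(\emptyset)=0$, $\widehat\psi(f)=\int_0^\infty\psi\{f\ge t\}\,dt$ if $f\ge0$ and $\widehat\psi(f)=\widehat\psi(f+c)-c\psi(J)$ for any $c\ge\|f\|$; and $\widehat\varphi=\widehat\mu-\widehat\nu$. Equivalently, $\widehat\varphi(f)=\int_{-c}^c\varphi\{f\ge t\}\,dt-c\varphi(J)$ for any $c\ge\|f\|$. (Bounded submodular setfunctions have bounded variation, so $\widehat\varphi$ is defined here.) *)

(* Defs.v *)
From HB Require Import structures.
From mathcomp Require Import all_boot all_order all_algebra.
From mathcomp Require Import all_classical all_reals all_analysis.

Set Implicit Arguments.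
Unset Strict Implicit.
Unset Printing Implicit Defensive.

Import Order.TTheory GRing.Theory Num.Theory.
Import numFieldNormedType.Exports.

Local Open Scope classical_set_scope.
Local Open Scope ring_scope.

(* A setfunction on the sigma-algebra B of J is a total function set J -> R of
   which only the values on measurable sets are ever constrained or used. *)

Section setfunctions.
Context {R : realType} {d : measure_display} {J : measurableType d}.
Implicit Types (phi psi : set J -> R) (f : J -> R).

Definition submodular phi : Prop :=
  forall X Y : set J, measurable X -> measurable Y ->
    phi (X `|` Y) + phi (X `&` Y) <= phi X + phi Y.

Definition unif_continuous_wrt (P : probability J R) phi : Prop :=
  forall eps : R, 0 < eps ->
    exists2 delta : R, 0 < delta &
      forall S T : set J, measurable S -> measurable T ->
        (P (S `+` T) < delta%:E)%E -> `|phi S - phi T| < eps.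

Definition measurable_chain (n : nat) (X : nat -> set J) (S : set J) : Prop :=
  [/\ X 0%N = set0, X n = S,
      (forall i, (i <= n)%N -> measurable (X i)) &
      (forall i, (i < n)%N -> X i `<=` X i.+1)].

(* The two increasing parts mu and nu of phi = mu - nu.  They are meaningful
   when phi has bounded variation; [sup] is 0 on unbounded sets. *)
Definition pos_variation phi (S : set J) : R :=
  sup [set v : R | exists (n : nat) (X : nat -> set J),
    measurable_chain n X S /\
    v = \sum_(i < n) Num.max 0 (phi (X i.+1) - phi (X i))].

Definition neg_variation phi (S : set J) : R :=
  sup [set v : R | exists (n : nat) (X : nat -> set J),
    measurable_chain n X S /\
    v = \sum_(i < n) Num.max 0 (phi (X i) - phi (X i.+1))].

Definition supnorm f : R := sup (range (fun y => `|f y|)).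

Definition choquet_ge0 psi f : R :=
  \int[lebesgue_measure]_(t in `[0%R, +oo[) psi [set y | t <= f y].

(* For increasing psi with psi set0 = 0, the value
   choquet_ge0 psi (f + c) - c * psi setT is the same for all c >= supnorm f;
   we take c = supnorm f. *)
Definition choquet_incr psi f : R :=
  if `[< forall y, 0 <= f y >] then choquet_ge0 psi f
  else choquet_ge0 psi (fun y => f y + supnorm f) - supnorm f * psi setT.

Definition choquet phi f : R :=
  choquet_incr (pos_variation phi) f - choquet_incr (neg_variation phi) f.

End setfunctions.

(* Main.v *)
Require Import Defs.
From HB Require Import structures.
From mathcomp Require Import all_boot all_order all_algebra.
From mathcomp Require Import all_classical all_reals all_analysis.
From mathcomp Require Import measurable_realfun ring lra.

Set Implicit Arguments.
Unset Strict Implicit.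
Unset Printing Implicit Defensive.

Import Order.TTheory GRing.Theory Num.Theory.
Import numFieldNormedType.Exports.

Local Open Scope classical_set_scope.
Local Open Scope ring_scope.

(** Write [V f] for the integral of [phi {f >= t}] over [t >= 0]. Up to a constant,
    the Choquet extension of [phi] at a function bounded by [c] is [V] of the
    function shifted by [c]. Submodularity of [phi] at the sets [{s >= t}] and
    [{s >= t - w} & B] gives [V (s + w 1_B) <= V s + w phi B], hence
    [V (sum w_i 1_(B_i)) <= sum w_i phi (B_i)].

    Let [E] be the hypograph of the shifted [F], seen as a family of subsets [E_z]
    of [J] indexed by [z = (x, t)] in [I * R]. A sigma-algebra induction shows that
    countably many sets [B_i] come arbitrarily close in [P]-measure to every [E_z].
    This makes [z |-> phi E_z] measurable, and it approximates the average of the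
    indicators of the [E_z], which is the shifted [g], in [L^1(P)] by finite sums
    [sum w_i 1_(B_i)] such that [sum w_i phi (B_i)] is close to the integral of
    [phi E_z]. Since [V] is continuous in [L^1(P)] on uniformly bounded functions,
    the inequality passes to the limit. *)

(** * Measures of unions and symmetric differences *)

(** Continuity from above along the remainders, which decrease to the empty set. It truncates
    countable unions, both for sections and for the mixture. *)
Lemma measure_bigcup_tail_lt {R : realType} {d : measure_display}
    {T : measurableType d} (m : {measure set T -> \bar R}) (X : (set T)^nat) (e : R) :
  (forall k, measurable (X k)) -> (m (\bigcup_k X k) < +oo)%E -> 0 < e ->
  exists n, (m (\bigcup_k X k `\` \big[setU/set0]_(k < n) X k) < e%:E)%E.
Proof.
move=> mX Xoo e0; pose U n := \big[setU/set0]_(k < n) X k.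
have mU n : measurable (U n) by exact: bigsetU_measurable.
have mUX : measurable (\bigcup_k X k) by exact: bigcup_measurable.
have mD n : measurable (\bigcup_k X k `\` U n) by exact: measurableD.
have Doo n : (m (\bigcup_k X k `\` U n) < +oo)%E.
  by apply: le_lt_trans Xoo; apply: le_measure; rewrite ?inE//; exact: subDsetl.
have UE : \bigcap_n (\bigcup_k X k `\` U n) = set0.
  rewrite -subset0 => y hy; have [[k _ Xky] _] := hy 0%N I.
  have [_] := hy k.+1 I; apply; rewrite /U -bigcup_mkord.
  by exists k => /=.
have : m (\bigcup_k X k `\` U n) @[n --> \oo] --> m set0.
  rewrite -UE; apply: nonincreasing_cvg_mu => //.
    exact: bigcap_measurable.
  by move=> n k nk; apply/subsetPset; apply: setDS; exact: subset_bigsetU.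
rewrite measure0 => /fine_cvgP[_ /cvgrPdist_lt/(_ _ e0)].
move=> [N _ /(_ N (leqnn N))] /=; rewrite sub0r normrN => hN; exists N.
rewrite -[ltLHS]fineK ?lte_fin; last first.
  by rewrite ge0_fin_numE//; exact: Doo.
exact: le_lt_trans (ler_norm _) hN.
Qed.

(** The measure of [A & B] cancels in the difference, and the two remaining pieces are the disjoint
    halves of the symmetric difference. *)
Lemma distr_measure_le {R : realType} {d : measure_display}
    {T : measurableType d} (m : {measure set T -> \bar R}) (A B : set T) :
  measurable A -> measurable B -> (m A < +oo)%E -> (m B < +oo)%E ->
  (`|fine (m A) - fine (m B)|%:E <= m (A `+` B))%E.
Proof.
move=> mA mB Aoo Boo.
have mAB : measurable (A `\` B) by exact: measurableD.
have mBA : measurable (B `\` A) by exact: measurableD.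
have lt S T' : measurable S -> measurable T' -> (m T' < +oo)%E -> S `<=` T' ->
    m S \is a fin_num.
  move=> mS mT Too ST; rewrite ge0_fin_numE//; apply: le_lt_trans Too.
  by apply: le_measure; rewrite ?inE.
have fAB : m (A `\` B) \is a fin_num by exact: (lt _ A).
have fBA : m (B `\` A) \is a fin_num by exact: (lt _ B).
have mI : measurable (A `&` B) by exact: measurableI.
have fI : m (A `&` B) \is a fin_num by exact: (lt _ A).
have split S T' : measurable S -> measurable T' ->
    m S = (m (S `&` T') + m (S `\` T'))%E.
  move=> mS mT; rewrite -measureU ?setUIDK//; [exact: measurableI|
    exact: measurableD|by rewrite setDE setIACA setICr setI0].
rewrite setY_def measureU//; last first.
  by rewrite !setDE setIACA (setIC _ (~` A)) setIACA setICr set0I.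
have -> : (m (A `\` B) + m (B `\` A) =
    (fine (m (A `\` B)) + fine (m (B `\` A)))%:E)%E by rewrite EFinD !fineK.
rewrite lee_fin (split A B)// (split B A)// (setIC B) !fineD//.
rewrite opprD addrACA subrr add0r.
by rewrite (le_trans (ler_normB _ _))// !ger0_norm// fine_ge0.
Qed.

(** * Bounded variation of bounded submodular setfunctions *)

Section bounded_setfunction.
Context {R : realType} {d : measure_display} {J : measurableType d}.
Variables (P : probability J R) (phi : set J -> R).
Hypothesis phi_ge0 : forall X : set J, measurable X -> 0 <= phi X.
Hypothesis phi_submod : submodular phi.
Hypothesis phi0 : phi set0 = 0.
Hypothesis phi_ucont : unif_continuous_wrt P phi.

Lemma submodular_subadditive (X Y : set J) : measurable X -> measurable Y ->
  phi (X `|` Y) <= phi X + phi Y.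
Proof.
move=> mX mY; apply: le_trans (phi_submod mX mY).
by rewrite lerDl phi_ge0//; exact: measurableI.
Qed.

Let unbounded (A : set J) : Prop := measurable A /\
  ~ exists K : R, forall S, measurable S -> S `<=` A -> phi S <= K.

(** By subadditivity, bounds on the subsets of both pieces would add up to a bound on the subsets of
    [A]. *)
Let unbounded_split (A B : set J) : unbounded A -> measurable B ->
  unbounded (A `&` B) \/ unbounded (A `\` B).
Proof.
move=> [mA uA] mB; apply: contrapT => /not_orP[nI nD]; apply: uA.
have mI : measurable (A `&` B) by exact: measurableI.
have mD : measurable (A `\` B) by exact: measurableD.
have [K1 hK1] : exists K : R,
    forall S, measurable S -> S `<=` A `&` B -> phi S <= K.
  by apply: contrapT => h; apply: nI.
have [K2 hK2] : exists K : R,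
    forall S, measurable S -> S `<=` A `\` B -> phi S <= K.
  by apply: contrapT => h; apply: nD.
exists (K1 + K2) => S mS SA.
rewrite -(setUIDK S B) (le_trans (submodular_subadditive _ _))//.
- exact: measurableI.
- exact: measurableD.
- by rewrite lerD// ?hK1 ?hK2//; [exact: measurableI|exact: setSI|
    exact: measurableD|exact: setSD].
Qed.

(* Otherwise take a set [A] on the subsets of which [phi] is unbounded, of almost
   minimal measure: every subset of [A] is then close to [set0] or to [A]. *)
Lemma unif_continuous_bounded :
  exists K : R, forall S, measurable S -> phi S <= K.
Proof.
apply: contrapT => nb.
have [delta delta0 hdelta] := phi_ucont ltr01.
have uT : unbounded setT.
  by split => // -[K hK]; apply: nb; exists K => S mS; exact: hK.
pose E := [set r : R | exists2 B, unbounded B & r = fine (P B)].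
have hE : has_inf E.
  split; first by exists (fine (P setT)), setT.
  by exists 0 => _ [B _ ->]; rewrite fine_ge0.
have [_ [A uA ->] ltA] := inf_adherent delta0 hE.
have minA B : unbounded B -> fine (P A) < fine (P B) + delta.
  move=> uB; apply: lt_le_trans ltA _; rewrite lerD2r.
  by apply: ge_inf; [exact: hE.2|exists B].
(* The bound [phi A + 1] fits both cases: [S] is [delta]-close either to [A], and [phi S] is within
   1 of [phi A], or to [set0], and [phi S] is below 1. *)
have [mA nA] := uA; apply: nA; exists (phi A + 1) => S mS SA.
have fin B : measurable B -> P B \is a fin_num by move=> mB; exact: fin_num_measure.
have mD : measurable (A `\` S) by exact: measurableD.
have PA : fine (P A) = fine (P S) + fine (P (A `\` S)).
  rewrite -fineD ?fin//; congr fine.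
  rewrite -measureU//; first by rewrite setDUK.
  by rewrite setDE setICA setICr setI0.
have [|] := unbounded_split uA mS.
- rewrite (setIidr SA) => /minA; rewrite PA => lt.
  have : `|phi S - phi A| < 1.
    apply: hdelta => //; rewrite setYC setY_def (_ : S `\` A = set0) ?setU0.
      by rewrite -(fineK (fin _ mD)) lte_fin; lra.
    by rewrite setD_eq0.
  by rewrite ltr_distlC => /andP[? ?]; lra.
- move=> /minA; rewrite PA => lt.
  have : `|phi S - phi set0| < 1.
    apply: hdelta => //; rewrite setY0.
    by rewrite -(fineK (fin _ mS)) lte_fin; lra.
  rewrite phi0 subr0 ltr_norml => /andP[_ /ltW h].
  by apply: le_trans h _; rewrite lerDr phi_ge0.
Qed.

End bounded_setfunction.

(** * Increasing parts of a bounded submodular setfunction *)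

Section variation.
Context {R : realType} {d : measure_display} {J : measurableType d}.
Implicit Types (phi : set J -> R) (g : set J -> set J -> R) (S T : set J).

(** Common form of both variations: each is the supremum of such a set, for its own increment
    [g]. *)
Definition chain_sums g S : set R := [set v : R |
  exists (n : nat) (X : nat -> set J),
    measurable_chain n X S /\ v = \sum_(i < n) g (X i) (X i.+1)].

Lemma chain_sums_nonempty g S : measurable S -> chain_sums g S !=set0.
Proof.
move=> mS; exists (\sum_(i < 1) g set0 S).
exists 1%N, (fun i => if i == 0%N then set0 else S).
split; last by rewrite !big_ord1.
split => // i _; first by case: ifPn.
by move=> t /=; case: ifPn.
Qed.

(** Append [T] as a last link to the chain ending in [S]; the new increment is nonnegative. *)
Lemma chain_sums_sub g S T v : (forall A B, 0 <= g A B) ->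
  measurable S -> measurable T -> S `<=` T ->
  chain_sums g S v -> exists2 w, chain_sums g T w & v <= w.
Proof.
move=> g0 mS mT ST [n [X [[X0 Xn mX sX] ->]]].
pose Y i := if (i <= n)%N then X i else T.
exists (\sum_(i < n.+1) g (Y i) (Y i.+1)).
  exists n.+1, Y; split => //; split.
  - by rewrite /Y leq0n.
  - by rewrite /Y ltnn.
  - by move=> i _; rewrite /Y; case: ifPn => // ?; exact: mX.
  - move=> i; rewrite ltnS /Y => iN; rewrite iN.
    case: ifPn => [|]; first exact: sX.
    rewrite -leqNgt => ni; have -> : i = n by apply/eqP; rewrite eqn_leq iN.
    by rewrite Xn.
rewrite big_ord_recr/= -[X in X <= _]addr0 lerD//.
rewrite le_eqVlt; apply/orP; left; apply/eqP; apply: eq_bigr => i _.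
by rewrite /Y ltn_ord (ltnW (ltn_ord i)).
Qed.

Lemma le_sup_chain_sums g S T : (forall A B, 0 <= g A B) ->
  measurable S -> measurable T -> S `<=` T -> has_ubound (chain_sums g T) ->
  sup (chain_sums g S) <= sup (chain_sums g T).
Proof.
move=> g0 mS mT ST ubT; apply: ge_sup; first exact: chain_sums_nonempty.
move=> v /(chain_sums_sub g0 mS mT ST)[w Tw /le_trans]; apply.
exact: ub_le_sup.
Qed.

(* [U] is the union of the differences [X (i+1) \ X i] on which [phi] increases. *)
Lemma submodular_chain_sum phi n (X : nat -> set J) S :
  submodular phi -> phi set0 = 0 -> measurable_chain n X S ->
  exists U, [/\ measurable U, U `<=` S &
    \sum_(i < n) Num.max 0 (phi (X i.+1) - phi (X i)) <= phi U].
Proof.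
move=> sm phi0 [X0 <- mX sX].
suff h : forall k, (k <= n)%N ->
    exists U, [/\ measurable U, U `<=` X k &
    \sum_(i < k) Num.max 0 (phi (X i.+1) - phi (X i)) <= phi U] by exact: h.
elim=> [_|k IH kn].
  by exists set0; rewrite big_ord0 phi0; split.
have [U [mU UX leU]] := IH (ltnW kn).
have mk := mX _ (ltnW kn); have mk1 := mX _ kn; have sk := sX _ kn.
rewrite big_ord_recr/=; have [h|h] := leP (phi (X k.+1) - phi (X k)) 0.
  by exists U; split => //; [exact: subset_trans sk|rewrite addr0].
have mV : measurable (U `|` X k.+1 `\` X k).
  by apply: measurableU => //; exact: measurableD.
exists (U `|` X k.+1 `\` X k); split => //.
  by rewrite subUset; split; [exact: subset_trans sk|exact: subDsetl].
(* The union of these two sets is [X k.+1] and their intersection is [U], so the enlarged set gains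
   at least the increment of [phi] from [X k] to [X k.+1]. *)
have := sm _ _ mk mV.
rewrite setUA (setUidl UX) (setDUK sk).
have -> : X k `&` (U `|` X k.+1 `\` X k) = U.
  by rewrite setIUr (setIidr UX) setDE setICA setICr setI0 setU0.
by move=> ?; lra.
Qed.

Section bounded_submodular.
Variables (phi : set J -> R) (K : R).
Hypothesis phi_submod : submodular phi.
Hypothesis phi0 : phi set0 = 0.
Hypothesis phi_leK : forall S, measurable S -> phi S <= K.
Hypothesis phi_ge0 : forall S, measurable S -> 0 <= phi S.

Let posg (A B : set J) : R := Num.max 0 (phi B - phi A).
Let negg (A B : set J) : R := Num.max 0 (phi A - phi B).

Let posE S : pos_variation phi S = sup (chain_sums posg S). Proof. by []. Qed.
Let negE S : neg_variation phi S = sup (chain_sums negg S). Proof. by []. Qed.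

Let posg_ge0 A B : 0 <= posg A B. Proof. by rewrite /posg le_max lexx. Qed.
Let negg_ge0 A B : 0 <= negg A B. Proof. by rewrite /negg le_max lexx. Qed.

Let pos_ub S : ubound (chain_sums posg S) K.
Proof.
move=> v [n [X [ch ->]]].
have [U [mU _ /le_trans]] := submodular_chain_sum phi_submod phi0 ch; apply.
exact: phi_leK.
Qed.

(** Termwise, [max 0 a - max 0 (- a) = a], and the increments telescope from [phi set0 = 0] to
    [phi S]. *)
Let pos_neg_sum n X S : measurable_chain n X S ->
  \sum_(i < n) posg (X i) (X i.+1) =
  \sum_(i < n) negg (X i) (X i.+1) + phi S.
Proof.
move=> [X0 <- _ _]; apply/eqP; rewrite addrC -subr_eq -sumrB; apply/eqP.
transitivity (\sum_(i < n) (phi (X i.+1) - phi (X i))).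
  apply: eq_bigr => i _; rewrite /posg /negg.
  by case: leP => ?; case: leP => ?; lra.
by rewrite -(big_mkord xpredT (fun i => phi (X i.+1) - phi (X i)))
  telescope_sumr// X0 phi0 subr0.
Qed.

Let neg_ub S : measurable S -> ubound (chain_sums negg S) K.
Proof.
move=> mS v [n [X [ch ->]]].
have : \sum_(i < n) posg (X i) (X i.+1) <= K.
  by apply: (@pos_ub S); exists n, X.
by rewrite (pos_neg_sum ch); apply: le_trans; rewrite lerDl phi_ge0.
Qed.

(** By [pos_neg_sum], the positive and negative sums of each chain differ by the same constant
    [phi S]; hence so do the suprema. *)
Lemma variationB S : measurable S ->
  pos_variation phi S - neg_variation phi S = phi S.
Proof.
move=> mS; apply/eqP; rewrite subr_eq addrC eq_le posE negE; apply/andP; split.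
- apply: ge_sup; first exact: chain_sums_nonempty.
  move=> _ [n [X [ch ->]]]; rewrite (pos_neg_sum ch) lerD2r.
  apply: ub_le_sup; first by exists K; exact: neg_ub.
  by exists n, X.
- rewrite -lerBrDr; apply: ge_sup; first exact: chain_sums_nonempty.
  move=> _ [n [X [ch ->]]]; rewrite lerBrDr -(pos_neg_sum ch).
  by apply: ub_le_sup; [exists K; exact: pos_ub|exists n, X].
Qed.

Lemma le_pos_variation S T : measurable S -> measurable T -> S `<=` T ->
  pos_variation phi S <= pos_variation phi T.
Proof.
by move=> mS mT ST; rewrite !posE; apply: le_sup_chain_sums => //; exists K;
  exact: pos_ub.
Qed.

Lemma le_neg_variation S T : measurable S -> measurable T -> S `<=` T ->
  neg_variation phi S <= neg_variation phi T.
Proof.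
by move=> mS mT ST; rewrite !negE; apply: le_sup_chain_sums => //; exists K;
  exact: neg_ub.
Qed.

Lemma pos_variation0 : pos_variation phi set0 = 0.
Proof.
apply/eqP; rewrite eq_le posE; apply/andP; split.
  apply: ge_sup; first exact: chain_sums_nonempty measurable0.
  move=> _ [n [X [ch ->]]].
  have [U [_ U0 /le_trans]] := submodular_chain_sum phi_submod phi0 ch; apply.
  by move: U0; rewrite subset0 => ->; rewrite phi0.
have [v [n [X [ch vE]]]] := chain_sums_nonempty posg (@measurable0 _ J).
apply: (@le_trans _ _ v); first by rewrite vE sumr_ge0.
by apply: ub_le_sup; [exists K; exact: pos_ub|exists n, X].
Qed.

Lemma neg_variation0 : neg_variation phi set0 = 0.
Proof.
by have := variationB measurable0; rewrite pos_variation0 phi0 sub0r => /eqP;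
  rewrite oppr_eq0 => /eqP.
Qed.

End bounded_submodular.
End variation.

(** * Measurability of setfunctions on sections *)

Lemma measurable_setY {d : measure_display} {T : measurableType d} (A B : set T) :
  measurable A -> measurable B -> measurable (A `+` B).
Proof. by move=> *; rewrite setY_def; apply: measurableU; exact: measurableD. Qed.

Section separable_sections.
Context {R : realType} {dZ d : measure_display}.
Context {Z : measurableType dZ} {J : measurableType d}.
Variable P : probability J R.

(** Separability of the family of sections for the pseudometric [P (S + T)] of symmetric
    differences. One sequence [B] serves all [z], and its members need not be sections of [E]. *)
Definition separable_sections (E : set (Z * J)) : Prop :=
  exists2 B : nat -> set J, (forall i, measurable (B i)) &
    forall z (e : R), 0 < e -> exists i, (P (xsection E z `+` B i) < e%:E)%E.

Lemma xsection_setY (E E' : set (Z * J)) (z : Z) :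
  xsection (E `+` E') z = xsection E z `+` xsection E' z.
Proof. by rewrite !setY_def !xsectionE. Qed.

Lemma measurable_fun_xsection_setY (E : set (Z * J)) (B : set J) :
  measurable E -> measurable B ->
  measurable_fun setT (fun z => P (xsection E z `+` B)).
Proof.
move=> mE mB; have mX : measurable ((setT : set Z) `*` B) by exact: measurableX.
have := measurable_fun_xsection P (measurable_setY mE mX).
congr (measurable_fun _ _); apply/funext => z /=.
by rewrite xsection_setY in_xsectionX// in_setT.
Qed.

Lemma separable_sections_setX (A : set Z) (B : set J) :
  measurable B -> separable_sections (A `*` B).
Proof.
move=> mB; exists (fun i => if i == 0%N then B else set0).
  by move=> i; case: ifPn.
move=> z e e0; have [zA|zA] := boolP (z \in A).
  by exists 0%N; rewrite in_xsectionX// setYK measure0 lte_fin.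
by exists 1%N; rewrite notin_xsectionX// setYK measure0 lte_fin.
Qed.

(** Complementing both sets leaves their symmetric difference unchanged. *)
Lemma separable_sectionsC (E : set (Z * J)) :
  separable_sections E -> separable_sections (~` E).
Proof.
move=> [B mB hB]; exists (fun i => ~` B i); first by move=> i; exact: measurableC.
move=> z e e0; have [i hi] := hB z e e0; exists i; apply: le_lt_trans hi.
rewrite (_ : _ `+` _ = xsection E z `+` B i)// !setY_def.
rewrite (_ : xsection (~` E) z = ~` xsection E z); last by rewrite !xsectionE.
by rewrite !setDE !setCK setUC; congr setU; rewrite setIC.
Qed.

(** The approximants are the finite unions taking one member from each of the first sequences. They
    are countably many, being coded by finite sequences of indices. *)
Lemma separable_sections_bigcup (E : (set (Z * J))^nat) :
  (forall k, measurable (E k)) -> (forall k, separable_sections (E k)) ->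
  separable_sections (\bigcup_k E k).
Proof.
move=> mE sE.
have /choice[B /all_and2[mB hB]] : forall k, exists B : nat -> set J,
    (forall i, measurable (B i)) /\ (forall z (e : R), 0 < e ->
      exists i, (P (xsection (E k) z `+` B i) < e%:E)%E).
  by move=> k; have [B mB hB] := sE k; exists B.
pose C (s : seq nat) := \big[setU/set0]_(k < size s) B k (nth 0%N s k).
have mC s : measurable (C s) by exact: bigsetU_measurable.
exists (C \o CodeSeq.decode); first by move=> i; exact: mC.
move=> z e e0; pose X k := xsection (E k) z.
have mX k : measurable (X k) by exact: measurable_xsection.
pose U n := \big[setU/set0]_(k < n) X k.
have mU n : measurable (U n) by exact: bigsetU_measurable.
have mUX : measurable (\bigcup_k X k) by exact: bigcup_measurable.
have e20 : 0 < e / 2 by rewrite divr_gt0.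
have [n hn] : exists n, (P (\bigcup_k X k `\` U n) < (e / 2)%:E)%E.
  apply: measure_bigcup_tail_lt => //.
  exact: le_lt_trans (probability_le1 P mUX) (ltry 1).
(* Half of [e] pays for the tail of the union and half for the [n] approximations; dividing by
   [n.+1] also covers [n = 0]. *)
have en0 : 0 < e / 2 / n.+1%:R by rewrite divr_gt0.
have /choice[i hi] : forall k, exists i,
    (P (X k `+` B k i) < (e / 2 / n.+1%:R)%:E)%E.
  by move=> k; exact: hB.
exists (CodeSeq.code (mkseq i n)); rewrite /= CodeSeq.codeK xsection_bigcup.
have CE : C (mkseq i n) = \big[setU/set0]_(k < n) B k (i k).
  rewrite /C -(big_mkord xpredT (fun k => B k (nth 0%N (mkseq i n) k))).
  rewrite -(big_mkord xpredT (fun k => B k (i k))) size_mkseq.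
  by apply: eq_big_nat => k /andP[_ kn]; rewrite nth_mkseq.
have sub : \bigcup_k X k `+` C (mkseq i n) `<=` (\bigcup_k X k `\` U n) `|`
    \big[setU/set0]_(k < n) (X k `+` B k (i k)).
  rewrite CE /U => y; rewrite setY_def -(bigcup_mkord n X)
    -(bigcup_mkord n (fun k => B k (i k)))
    -(bigcup_mkord n (fun k => X k `+` B k (i k))).
  move=> [[UXy nBy]|[[k kn By] nXy]].
    have [[k kn Xky]|nUy] := pselect ((\bigcup_(k in `I_n) X k) y); last by left.
    right; exists k => //; rewrite setY_def; left; split => // By.
    by apply: nBy; exists k.
  right; exists k => //; rewrite setY_def; right; split => // Xy.
  by apply: nXy; exists k.
have mS k : measurable (X k `+` B k (i k)) by exact: measurable_setY.
have mB' : measurable (\big[setU/set0]_(k < n) (X k `+` B k (i k))).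
  exact: bigsetU_measurable.
have mD : measurable (\bigcup_k X k `\` U n) by exact: measurableD.
apply: le_lt_trans (_ : (_ <= P (\bigcup_k X k `\` U n) +
    P (\big[setU/set0]_(k < n) (X k `+` B k (i k))))%E) _.
  apply: le_trans (measureU2 _ mD mB'); apply: le_measure => //; rewrite inE.
    exact: measurable_setY.
  exact: measurableU.
rewrite [e]splitr EFinD; apply: lte_leD => //.
  by apply: fin_num_measure.
apply: le_trans (_ : (_ <= \sum_(k < n) P (X k `+` B k (i k)))%E) _.
  have := @content_subadditive _ _ _ P _ (fun k => X k `+` B k (i k)) n.
  by apply => //; rewrite bigcup_mkord.
apply: le_trans (_ : (_ <= \sum_(k < n) (e / 2 / n.+1%:R)%:E)%E) _.
  by apply: lee_sum => k _; exact: ltW.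
rewrite sumEFin lee_fin sumr_const card_ord -[leLHS]mulr_natr.
by rewrite mulrAC ler_pdivrMr// ler_pM2l// ler_nat.
Qed.

(** Induction on the sigma-algebra generated by rectangles. The predicate includes measurability
    because the step for countable unions uses it. *)
Lemma measurable_separable_sections (E : set (Z * J)) :
  measurable E -> separable_sections E.
Proof.
suff : measurable `<=` [set E : set (Z * J) | measurable E /\ separable_sections E].
  by move=> h /h[].
rewrite [X in X `<=` _]measurable_prod_measurableType; apply: smallest_sub.
  split => [|A [mA sA]|A hA].
  - split; first exact: measurable0.
    by have := separable_sections_setX setT measurable0; rewrite setX0.
  - by rewrite setTD; split; [exact: measurableC|exact: separable_sectionsC].
  - split; first by apply: bigcup_measurable => k _; have [] := hA k.
    by apply: separable_sections_bigcup => k; have [] := hA k.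
move=> _ [A mA [B mB <-]]; split; first exact: measurableX.
exact: separable_sections_setX.
Qed.

Variable phi : set J -> R.
Hypothesis phi_ucont : unif_continuous_wrt P phi.

(** The section at [z] has value above [a] exactly when, for some [n], it is [delta n]-close to some
    [B i] with [phi (B i) > a + 1/(n+1)]. This is a countable union of measurable conditions on
    [z]. *)
Lemma measurable_fun_setfun_xsection (E : set (Z * J)) : measurable E ->
  measurable_fun setT (fun z => phi (xsection E z)).
Proof.
move=> mE; have [B mB hB] := measurable_separable_sections mE.
have /choice[delta /all_and2[d0 hd]] : forall n, exists delta : R,
    0 < delta /\ forall S T, measurable S -> measurable T ->
      (P (S `+` T) < delta%:E)%E -> `|phi S - phi T| < n.+1%:R^-1.
  move=> n; have n0 : 0 < n.+1%:R^-1 :> R by rewrite invr_gt0.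
  by have [e e0 he] := phi_ucont n0; exists e.
have mX z : measurable (xsection E z) by exact: measurable_xsection.
apply: (measurability (@RGenOInfty.G R)) => [|/= _ [_] [a] -> <-].
  exact: RGenOInfty.measurableE.
rewrite setTI (_ : _ @^-1` _ = \bigcup_n \bigcup_(i in [set i |
    a + n.+1%:R^-1 < phi (B i)])
    [set z | P (xsection E z `+` B i) < (delta n)%:E]%E).
  apply: bigcup_measurable => n _; apply: bigcup_measurable => i _.
  have mf := measurable_fun_xsection_setY mE (mB i).
  rewrite -[X in measurable X]setTI; exact: emeasurable_fun_infty_o.
apply/seteqP; split => z /=; rewrite in_itv/= andbT.
  (* With [1/(n+1)] below half the gap, an approximant within [1/(n+1)] of the value at the section
     still exceeds [a + 1/(n+1)]. *)
  move=> lt; have e0 : 0 < (phi (xsection E z) - a) / 2.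
    by rewrite divr_gt0// subr_gt0.
  have [n hn] : exists n, n.+1%:R^-1 < (phi (xsection E z) - a) / 2.
    exists (Num.truncn ((phi (xsection E z) - a) / 2)^-1).
    rewrite invf_plt ?posrE//; exact: truncnS_gt.
  have [i hi] := hB z _ (d0 n).
  exists n => //; exists i => //=.
  have := hd n _ _ (mX z) (mB i) hi; move: hn; set q := _^-1.
  by rewrite ltr_distlC => ? /andP[? ?]; lra.
move=> [n _ [i /= hi]] /(hd n _ _ (mX z) (mB i)); move: hi; set q := _^-1.
by rewrite ltr_distlC => ? /andP[? ?]; lra.
Qed.

End separable_sections.

(** * Integrals over superlevel sets *)

Section lebesgue_halfline.
Context {R : realType}.
Local Notation mu := (@lebesgue_measure R).

Definition translation (w : R) : measurableTypeR R -> measurableTypeR R :=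
  fun t : R => t - w.

Let measurable_translation (w : R) : measurable_fun setT (translation w).
Proof. exact: measurable_funB. Qed.

HB.instance Definition _ (w : R) :=
  measurable_function.isMeasurableFun.Build _ _ _ _ (translation w)
    (measurable_translation w).

(** Uniqueness of Lebesgue measure, checked on half-open intervals. *)
Lemma lebesgue_measure_translation (w : R) (A : set R) : measurable A ->
  pushforward mu (translation w) A = mu A.
Proof.
move=> mA; apply/esym/lebesgue_measure_unique => //= _ [[a b]] _ <-.
rewrite /pushforward (_ : _ @^-1` _ = `]a + w, b + w]%classic); last first.
  apply/seteqP; split => t /=;
  by rewrite /translation !in_itv/= ltrBrDr lerBlDr.
rewrite !lebesgue_measure_itv/= !lte_fin ltrD2r; case: ifPn => // _.
by rewrite -!EFinB; congr EFin; ring.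
Qed.

(** Substituting [t - w] moves the domain to [[- w, +oo[], and [h] equals [c] on the added interval
    [[- w, 0[]. It is meant for functions of superlevel sets of nonnegative functions, which are
    constant at negative levels. *)
Lemma ge0_integral_halfline_shift (h : R -> R) (w c : R) :
  measurable_fun setT h -> (forall t, 0 <= h t) -> 0 <= w ->
  (forall t, t < 0 -> h t = c) ->
  (\int[mu]_(t in `[0%R, +oo[) (h (t - w))%:E =
   (w * c)%:E + \int[mu]_(t in `[0%R, +oo[) (h t)%:E)%E.
Proof.
move=> mh h0 w0 hc.
have mE : measurable_fun [set: R] (EFin \o h) by exact/measurable_EFinP.
transitivity (\int[mu]_(t in `[(- w)%R, +oo[) (h t)%:E)%E.
  rewrite (_ : `[0%R, +oo[%classic = translation w @^-1` `[- w, +oo[); last first.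
    apply/seteqP; split => t /=;
    by rewrite /translation !in_itv/= !andbT -[X in X <= _ - _]add0r lerD2r.
  rewrite -(@ge0_integral_pushforward _ _ _ _ _ _ (measurable_translation w)
    mu `[- w, +oo[ (EFin \o h))//.
  - by apply: eq_measure_integral => A mA _; exact: lebesgue_measure_translation.
  - exact: measurable_funS mE.
  - by move=> t _; rewrite lee_fin.
have -> : `[- w, +oo[%classic = `[- w, 0[%classic `|` `[0%R, +oo[%classic.
  by rewrite -itv_bndbnd_setU// ?bnd_simp// oppr_le0.
rewrite ge0_integral_setU//; last 3 first.
- exact: measurable_funS mE.
- by move=> t _; rewrite lee_fin.
- apply/disj_setPLR => t /=; rewrite !in_itv/= andbT => /andP[_ t0].
  by rewrite leNgt t0.
congr (_ + _)%E; rewrite (eq_integral (cst c%:E)); last first.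
  by move=> t; rewrite inE/= in_itv/= => /andP[_ t0]; rewrite hc.
rewrite integral_cst//= lebesgue_measure_itv/= lte_fin oppr_lt0.
case: ifPn => [_|]; first by rewrite -EFinB -EFinM; congr EFin; ring.
by rewrite -leNgt => w0'; rewrite mule0 (_ : w = 0) ?mul0r//; apply/eqP;
  rewrite eq_le w0' w0.
Qed.

Lemma ge0_integral_halfline_le (h : R -> R) (K C : R) :
  measurable_fun setT h -> (forall t, 0 <= h t <= K) -> 0 <= C ->
  (forall t, C < t -> h t = 0) ->
  (\int[mu]_(t in `[0%R, +oo[) (h t)%:E <= (K * C)%:E)%E.
Proof.
move=> mh hK C0 hC.
have K0 : 0 <= K by have /andP[] := hK 0 => /le_trans; exact.
apply: (@le_trans _ _ (\int[mu]_(t in `[0%R, +oo[) (K%:E * (\1_`[0, C] t)%:E))%E).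
  apply: ge0_le_integral => //.
  - by move=> t _; rewrite lee_fin; have /andP[] := hK t.
  - by apply/measurable_EFinP; exact: measurable_funS mh.
  - apply: measurable_funeM; apply/measurable_EFinP.
    exact: measurable_indic.
  - move=> t /=; rewrite in_itv/= andbT -EFinM lee_fin indicE => t0.
    have [tC|tC] := leP t C.
      by rewrite mem_set/= ?in_itv/= ?t0// mulr1; have /andP[] := hK t.
    by rewrite hC// mulr_ge0.
rewrite ge0_integralZl//; last first.
  by apply/measurable_EFinP; exact: measurable_indic.
rewrite integral_indic// (_ : _ `&` _ = `[0, C]%classic); last first.
  by apply/setIidl => t /=; rewrite !in_itv/= => /andP[->].
rewrite [X in (_ * X)%E]lebesgue_measure_itv/= lte_fin.
case: ifPn => [_|_]; last by rewrite mule0 lee_fin mulr_ge0.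
by rewrite -EFinB -EFinM subr0.
Qed.

End lebesgue_halfline.

(** * Level integral: measurability, shifts and submodularity *)

Section level_integral.
Context {R : realType} {d : measure_display} {J : measurableType d}.
Local Notation mu := (@lebesgue_measure R).

(** The [V] of the overview. [choquet_ge0] is its [fine]; extended real values allow integrals of
    nonnegative functions to be handled before finiteness is known. *)
Definition level_integral (psi : set J -> R) (f : J -> R) : \bar R :=
  (\int[mu]_(t in `[0%R, +oo[) (psi [set y | (t <= f y)%R])%:E)%E.

Lemma measurable_superlevel (f : J -> R) (t : R) :
  measurable_fun setT f -> measurable [set y | t <= f y].
Proof.
by move=> mf; rewrite -[X in measurable X]setTI; exact: measurable_fun_le.
Qed.

(** Its section at [t] is the superlevel set of [f] at [t], so the results on sections apply to
    superlevel sets. *)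
Lemma measurable_subgraph (f : J -> R) : measurable_fun setT f ->
  measurable ([set z | z.1 <= f z.2] : set (measurableTypeR R * J)).
Proof.
move=> mf; rewrite -[X in measurable X]setTI; apply: measurable_fun_le => //.
exact: measurableT_comp.
Qed.

Section increasing.
Variables (psi : set J -> R) (f : J -> R) (C : R).
Hypothesis psi_incr : forall S T, measurable S -> measurable T -> S `<=` T ->
  psi S <= psi T.
Hypothesis psi0 : psi set0 = 0.
Hypothesis mf : measurable_fun setT f.
Hypothesis f_leC : forall y, f y <= C.
Hypothesis C0 : 0 <= C.

(** For the two variations of [phi]: measurability in [t] comes from monotonicity, and integrability
    from a bounded integrand vanishing beyond [C]. *)
Lemma integrable_increasing_superlevel :
  mu.-integrable `[0%R, +oo[ (EFin \o fun t : R => psi [set y | t <= f y]).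
Proof.
have ms t := measurable_superlevel t mf.
have psi_ge0 S : measurable S -> 0 <= psi S.
  by move=> mS; rewrite -psi0; apply: psi_incr.
have mpsi : measurable_fun setT (fun t : R => psi [set y | t <= f y]).
  apply: nonincreasing_measurable => // s t st; apply: psi_incr => //.
  by move=> y /=; exact: le_trans.
apply/integrableP; split; first by apply/measurable_EFinP; exact: measurable_funTS.
under eq_integral do rewrite /= ger0_norm ?psi_ge0//.
apply: le_lt_trans (ltry (psi setT * C)).
apply: (ge0_integral_halfline_le mpsi) => // t; first by rewrite psi_ge0//= psi_incr.
move=> Ct; rewrite (_ : [set y | _] = set0) ?psi0// -subset0 => y /=.
by rewrite leNgt (le_lt_trans (f_leC y)).
Qed.

End increasing.

Variables (P : probability J R) (phi : set J -> R) (K : R).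
Hypothesis phi_ge0 : forall X : set J, measurable X -> 0 <= phi X.
Hypothesis phi_submod : submodular phi.
Hypothesis phi0 : phi set0 = 0.
Hypothesis phi_ucont : unif_continuous_wrt P phi.
Hypothesis phi_leK : forall S, measurable S -> phi S <= K.

(** As [phi] need not be monotone, measurability in [t] is obtained by viewing these sets as
    sections of one measurable set. *)
Lemma measurable_fun_superlevelI (f : J -> R) (B : set J) :
  measurable_fun setT f -> measurable B ->
  measurable_fun [set: R] (fun t : R => phi ([set y | t <= f y] `&` B)).
Proof.
move=> mf mB.
pose E : set (measurableTypeR R * J) := [set z | z.1 <= f z.2] `&` (setT `*` B).
have mE : measurable E.
  by apply: measurableI; [exact: measurable_subgraph|exact: measurableX].
rewrite (_ : (fun t => _) = fun t => phi (xsection E t)).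
  exact: (measurable_fun_setfun_xsection phi_ucont mE).
apply/funext => t; congr phi; rewrite xsectionE.
by apply/seteqP; split => y /=; [case|case=> ? []].
Qed.

Lemma measurable_fun_superlevel (f : J -> R) : measurable_fun setT f ->
  measurable_fun [set: R] (fun t : R => phi [set y | t <= f y]).
Proof.
move=> mf; rewrite (_ : (fun t => _) = fun t => phi ([set y | t <= f y] `&` setT)).
  exact: measurable_fun_superlevelI.
by apply/funext => t; rewrite setIT.
Qed.

Lemma level_integral_ge0 (f : J -> R) : measurable_fun setT f ->
  (0 <= level_integral phi f)%E.
Proof.
move=> mf; apply: integral_ge0 => t _; rewrite lee_fin phi_ge0//.
exact: measurable_superlevel.
Qed.

Let superlevelI_le (f : J -> R) (B : set J) (C : R) :
  measurable_fun setT f -> measurable B -> 0 <= C -> (forall y, f y <= C) ->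
  (\int[mu]_(t in `[0%R, +oo[) (phi ([set y | (t <= f y)%R] `&` B))%:E
   <= (K * C)%:E)%E.
Proof.
move=> mf mB C0 fC; have ms t := measurable_superlevel t mf.
apply: (ge0_integral_halfline_le (measurable_fun_superlevelI mf mB)) => // t.
  by rewrite phi_ge0 ?phi_leK//; exact: measurableI.
move=> Ct; rewrite (_ : _ `&` _ = set0) ?phi0// -subset0 => y /= [+ _].
by rewrite leNgt (le_lt_trans (fC y)).
Qed.

Lemma level_integral_le (f : J -> R) (C : R) :
  measurable_fun setT f -> 0 <= C -> (forall y, f y <= C) ->
  (level_integral phi f <= (K * C)%:E)%E.
Proof.
move=> mf C0 fC; rewrite (le_trans _ (superlevelI_le mf measurableT C0 fC))//.
by under [leRHS]eq_integral do rewrite setIT.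
Qed.

Lemma level_integral_fin_num (f : J -> R) (C : R) :
  measurable_fun setT f -> 0 <= C -> (forall y, f y <= C) ->
  level_integral phi f \is a fin_num.
Proof.
move=> mf C0 fC; rewrite ge0_fin_numE ?level_integral_ge0//.
exact: le_lt_trans (level_integral_le mf C0 fC) (ltry _).
Qed.

Lemma level_integralD_cst (f : J -> R) (c : R) :
  measurable_fun setT f -> (forall y, 0 <= f y) -> 0 <= c ->
  level_integral phi (fun y => f y + c) =
  ((c * phi setT)%:E + level_integral phi f)%E.
Proof.
move=> mf f0 c0; rewrite /level_integral.
rewrite -(ge0_integral_halfline_shift (measurable_fun_superlevel mf))//.
- by apply: eq_integral => t _; under eq_set do rewrite -lerBlDr.
- by move=> t; apply: phi_ge0; exact: measurable_superlevel.
- move=> t t0; rewrite (_ : [set y | _] = setT)// -subTset => y _ /=.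
  by rewrite (le_trans (ltW t0)).
Qed.

(* [{s + w 1_B >= t}] is the union of [{s >= t}] and [{s >= t - w} & B], and
   these two sets meet in [{s >= t} & B]. *)
Lemma level_integralD_indic (s : J -> R) (w C : R) (B : set J) :
  measurable_fun setT s -> 0 <= C -> (forall y, 0 <= s y <= C) ->
  0 <= w -> measurable B ->
  (level_integral phi (fun y => s y + w * \1_B y)%R
   <= level_integral phi s + (w * phi B)%:E)%E.
Proof.
move=> ms C0 sC w0 mB.
have s0 y : 0 <= s y by have /andP[] := sC y.
have ml t := measurable_superlevel t ms.
pose f y := s y + w * \1_B y; rewrite -/f.
have mf : measurable_fun setT f.
  apply: measurable_funD => //; apply: measurable_funM => //.
have mlf t := measurable_superlevel t mf.
have finI : (\int[mu]_(t in `[0%R, +oo[) (phi ([set y | (t <= s y)%R] `&` B))%:E)%E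
    \is a fin_num.
  rewrite ge0_fin_numE; last first.
    by apply: integral_ge0 => t _; rewrite lee_fin phi_ge0//; exact: measurableI.
  apply: le_lt_trans (superlevelI_le ms mB C0 _) (ltry _) => y.
  by have /andP[] := sC y.
(* Adding the finite integral of [phi ({s >= t} & B)] to both sides leaves the submodular inequality
   to be integrated over [t]; on the right, the shift by [w] absorbs [w * phi B]. *)
rewrite -(leeD2rE _ _ finI) /level_integral.
have mI := measurable_fun_superlevelI ms mB.
have mS := measurable_fun_superlevel ms.
have mF := measurable_fun_superlevel mf.
have shiftE : ((w * phi B)%:E + \int[mu]_(t in `[0%R, +oo[)
      (phi ([set y | (t <= s y)%R] `&` B))%:E = \int[mu]_(t in `[0%R, +oo[)
      (phi ([set y | (t - w <= s y)%R] `&` B))%:E)%E.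
  apply/esym; apply: (ge0_integral_halfline_shift mI) => // t.
    by rewrite phi_ge0//; exact: measurableI.
  move=> t0; rewrite (_ : [set y | _] = setT) ?setTI// -subTset => y _ /=.
  by rewrite (le_trans (ltW t0)).
rewrite -[leRHS]addeA shiftE.
have mIw : measurable_fun [set: R] (fun t => phi ([set y | t - w <= s y] `&` B)).
  have mw : measurable_fun [set: R] (fun t : R => t - w) by exact: measurable_funB.
  exact: (measurableT_comp mI mw).
have mE (h : R -> R) : measurable_fun setT h ->
    measurable_fun (`[0%R, +oo[%classic : set R) (fun t => (h t)%:E).
  by move=> mh; apply/measurable_EFinP; exact: measurable_funTS.
have pI t : 0 <= phi ([set y | t <= s y] `&` B).
  by rewrite phi_ge0//; exact: measurableI.
rewrite -!ge0_integralD//; try by [exact: mE|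
  move=> t _; rewrite lee_fin// phi_ge0].
apply: ge0_le_integral => //.
- by move=> t _; rewrite adde_ge0// lee_fin// phi_ge0.
- by apply: emeasurable_funD; exact: mE.
- by apply: emeasurable_funD; exact: mE.
move=> t _; rewrite -!EFinD lee_fin.
have mB' : measurable ([set y | t - w <= s y] `&` B) by exact: measurableI.
have := phi_submod (ml t) mB'; congr (phi _ + phi _ <= _).
- apply/seteqP; split => y /=; rewrite /f indicE.
    move=> [h|[h yB]]; first by rewrite (le_trans h)// lerDl mulr_ge0.
    by rewrite mem_set// mulr1 -lerBlDr.
  have [yB|yB] := boolP (y \in B); last by rewrite mulr0 addr0; left.
  by rewrite mulr1 -lerBlDr; right; split => //; exact/set_mem.
- apply/seteqP; split => y /= [h]; first by move=> [].
  by move=> yB; split => //; split => //; rewrite (le_trans _ h)// gerBl.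
Qed.

End level_integral.

(** * Simple functions, continuity in mean, and the Choquet extension *)

Section level_integral_theory.
Context {R : realType} {d : measure_display} {J : measurableType d}.
Local Notation mu := (@lebesgue_measure R).
Variables (P : probability J R) (phi : set J -> R) (K : R).
Hypothesis phi_ge0 : forall X : set J, measurable X -> 0 <= phi X.
Hypothesis phi_submod : submodular phi.
Hypothesis phi0 : phi set0 = 0.
Hypothesis phi_ucont : unif_continuous_wrt P phi.
Hypothesis phi_leK : forall S, measurable S -> phi S <= K.

Let K_ge0 : 0 <= K.
Proof. by rewrite (le_trans (phi_ge0 measurable0))// phi_leK. Qed.

(** One indicator is added at a time, the sum of the weights bounding the partial sum. The sets may
    overlap arbitrarily, which is where submodularity enters. *)
Lemma level_integral_simple_le (w : nat -> R) (B : nat -> set J) (n : nat) :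
  (forall i, 0 <= w i) -> (forall i, measurable (B i)) ->
  (level_integral phi (fun y => \sum_(i < n) w i * \1_(B i) y)%R
   <= (\sum_(i < n) w i * phi (B i))%:E)%E.
Proof.
move=> w0 mB; elim: n => [|n IH].
  rewrite big_ord0 (_ : (fun y => _) = cst 0); last first.
    by apply/funext => y; rewrite big_ord0.
  by rewrite -{2}(mulr0 K); apply: (level_integral_le phi_ge0 phi0 phi_ucont).
rewrite (_ : (fun y => _) = fun y =>
  \sum_(i < n) w i * \1_(B i) y + w n * \1_(B n) y); last by apply/funext => y; rewrite big_ord_recr.
rewrite big_ord_recr/= EFinD.
apply: le_trans (leeD2r _ IH).
apply: (level_integralD_indic (K := K) (C := \sum_(i < n) w i)
  phi_ge0 phi_submod phi0 phi_ucont phi_leK) => //.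
- apply: measurable_sum => i; apply: measurable_funM => //.
- by apply: sumr_ge0.
- move=> y; apply/andP; split.
    by apply: sumr_ge0 => i _; rewrite mulr_ge0.
  by apply: ler_sum => i _; rewrite -[leRHS]mulr1 ler_wpM2l.
Qed.

(** By Tonelli: for fixed [y], the levels [t] at which [y] lies in exactly one superlevel set are
    between [f y] and [h y]. *)
Lemma integral_superlevel_setY_le (f h : J -> R) :
  measurable_fun setT f -> measurable_fun setT h ->
  (\int[mu]_(t in `[0%R, +oo[)
     P ([set y | (t <= f y)%R] `+` [set y | (t <= h y)%R])
   <= \int[P]_y `|f y - h y|%:E)%E.
Proof.
move=> mf mh.
pose L (k : J -> R) : set (measurableTypeR R * J) := [set z | z.1 <= k z.2].
have mA : measurable (L f `+` L h).
  by apply: measurable_setY; exact: measurable_subgraph.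
have xE (t : R) : xsection (L f `+` L h) t =
    [set y | t <= f y] `+` [set y | t <= h y].
  by rewrite xsection_setY !xsectionE.
under eq_integral do rewrite -xE.
have mx := measurable_fun_xsection P mA.
apply: (@le_trans _ _ (\int[mu]_t P (xsection (L f `+` L h) t))%E).
  by apply: ge0_subset_integral.
have := indic_fubini_tonelli mu P mA.
rewrite indic_fubini_tonelli_FE// indic_fubini_tonelli_GE//= => ->.
apply: ge0_le_integral => //.
- exact: measurable_fun_ysection.
- apply/measurable_EFinP; apply: measurableT_comp => //.
  exact: measurable_funB.
move=> y _ /=.
apply: (@le_trans _ _ (mu `[Num.min (f y) (h y), Num.max (f y) (h y)])).
  apply: le_measure; rewrite ?inE//; first exact: measurable_ysection.
  rewrite ysectionE setY_def => t /=; rewrite in_itv/= /L/= le_max ge_min.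
  by move=> [[-> /negP]|[-> /negP]]; rewrite -ltNge => /ltW ->; rewrite ?orbT.
rewrite lebesgue_measure_itv/= lte_fin; case: ifPn => // _.
rewrite -EFinB lee_fin.
by case: (leP (f y) (h y)) => _; rewrite ?ler_norm// distrC ler_norm.
Qed.

(** At levels in [[0, C]] where the superlevel sets are [delta]-close the loss is at most [eps]; at
    the others [phi] is at most [K], hence at most [K / delta] times the measure of the symmetric
    difference, as in Markov's inequality. Beyond [C] the left side vanishes. *)
Lemma level_integral_continuity (f h : J -> R) (C eps delta : R) :
  measurable_fun setT f -> measurable_fun setT h -> (forall y, f y <= C) ->
  0 <= C -> 0 < eps -> 0 < delta ->
  (forall S T, measurable S -> measurable T ->
    (P (S `+` T) < delta%:E)%E -> `|phi S - phi T| < eps) ->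
  (level_integral phi f <= level_integral phi h + (eps * C)%:E +
     (K / delta)%:E * \int[P]_y `|f y - h y|%:E)%E.
Proof.
move=> mf mh fC C0 eps0 delta0 hdelta.
have mlf t := measurable_superlevel t mf.
have mlh t := measurable_superlevel t mh.
have Kd0 : 0 <= K / delta by rewrite divr_ge0// ltW.
have Kd0' : (0 <= (K / delta)%:E)%E by rewrite lee_fin.
pose S t := [set y | t <= f y] `+` [set y | t <= h y].
have mS t : measurable (S t) by exact: measurable_setY.
have mPS : measurable_fun [set: R] (fun t => P (S t)).
  have mA := measurable_setY (measurable_subgraph mf) (measurable_subgraph mh).
  have := measurable_fun_xsection P mA; congr (measurable_fun _ _).
  by apply/funext => t /=; rewrite xsection_setY !xsectionE.
have mE (k : R -> R) : measurable_fun setT k ->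
    measurable_fun (`[0%R, +oo[%classic : set R) (fun t => (k t)%:E).
  by move=> mk; apply/measurable_EFinP; exact: measurable_funTS.
have mI : measurable_fun setT (fun t : R => eps * \1_(`[0, C]%classic : set R) t).
  by apply: measurable_funM => //; exact: measurable_indic.
have mPS' : measurable_fun (`[0%R, +oo[%classic : set R) (fun t => P (S t)).
  exact: measurable_funTS.
apply: (@le_trans _ _ (\int[mu]_(t in `[0%R, +oo[)
    ((phi [set y | (t <= h y)%R])%:E + (eps * \1_(`[0%R, C]%classic : set R) t)%:E +
     (K / delta)%:E * P (S t)))%E).
  apply: ge0_le_integral => //.
  - by move=> t _; rewrite lee_fin phi_ge0.
  - apply: mE; exact: (measurable_fun_superlevel phi_ucont).
  - apply: emeasurable_funD; last exact: measurable_funeM.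
    apply: emeasurable_funD; apply: mE => //.
    exact: (measurable_fun_superlevel phi_ucont).
  move=> t /=; rewrite in_itv/= andbT => t0.
  have [tC|tC] := leP t C; last first.
    rewrite (_ : [set y | t <= f y] = set0).
      rewrite phi0 !adde_ge0// ?mule_ge0// lee_fin ?phi_ge0//.
      by rewrite mulr_ge0// ltW.
    by rewrite -subset0 => y /=; rewrite leNgt (le_lt_trans (fC y)).
  rewrite indicE mem_set/= ?in_itv/= ?t0// mulr1.
  have finS : P (S t) \is a fin_num by exact: fin_num_measure.
  rewrite -(fineK finS) -EFinM -!EFinD lee_fin.
  have [lt|le] := ltP (fine (P (S t))) delta.
    have : `|phi [set y | t <= f y] - phi [set y | t <= h y]| < eps.
      by apply: hdelta => //; rewrite -/(S t) -(fineK finS) lte_fin.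
    rewrite ltr_distl => /andP[_ lt'].
    apply: (le_trans (ltW lt')); rewrite lerDl mulr_ge0// fine_ge0//.
  apply: (@le_trans _ _ K); first exact: phi_leK.
  apply: (@le_trans _ _ (K / delta * fine (P (S t)))).
    by rewrite -mulrA ler_peMr// mulrC ler_pdivlMr// mul1r.
  by rewrite lerDr addr_ge0// ?phi_ge0// ltW.
rewrite ge0_integralD//; last 4 first.
- by move=> t _; rewrite adde_ge0// lee_fin ?phi_ge0// mulr_ge0// ltW.
- apply: emeasurable_funD; apply: mE => //.
  exact: (measurable_fun_superlevel phi_ucont).
- by move=> t _; rewrite mule_ge0.
- exact: measurable_funeM.
apply: leeD; last first.
  rewrite ge0_integralZl// lee_wpmul2l//.
  exact: integral_superlevel_setY_le.
rewrite ge0_integralD//; last 4 first.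
- by move=> t _; rewrite lee_fin phi_ge0.
- by apply: mE; exact: (measurable_fun_superlevel phi_ucont).
- by move=> t _; rewrite lee_fin mulr_ge0// ltW.
- exact: mE.
apply: leeD2l; apply: (ge0_integral_halfline_le mI) => //.
- by move=> t; rewrite indicE; case: (_ \in _);
    rewrite ?mulr1 ?mulr0 lexx (ltW eps0).
- move=> t Ct; rewrite indicE memNset ?mulr0//= in_itv/=.
  by move=> /andP[_]; rewrite leNgt Ct.
Qed.

Let choquet_ge0B (f : J -> R) (C : R) : measurable_fun setT f ->
  0 <= C -> (forall y, f y <= C) ->
  choquet_ge0 (pos_variation phi) f - choquet_ge0 (neg_variation phi) f =
  fine (level_integral phi f).
Proof.
move=> mf C0 fC; rewrite /choquet_ge0 -RintegralB//.
- rewrite /Rintegral /level_integral; congr fine; apply: eq_integral => t _.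
  rewrite (variationB phi_submod phi0 phi_leK phi_ge0)//.
  exact: measurable_superlevel.
- apply: (integrable_increasing_superlevel (C := C)) => //.
  + exact: (le_pos_variation phi_submod phi0 phi_leK).
  + exact: (pos_variation0 phi_submod phi0 phi_leK).
- apply: (integrable_increasing_superlevel (C := C)) => //.
  + exact: (le_neg_variation phi_submod phi0 phi_leK).
  + exact: (neg_variation0 phi_submod phi0 phi_leK).
Qed.

(** Brings both branches of the definition, no shift or a shift by [supnorm f], to an arbitrary
    bound [c], so that one shift can later serve a whole family of functions. *)
Lemma choquet_level_integral (f : J -> R) (c : R) :
  measurable_fun setT f -> (forall y, `|f y| <= c) -> 0 <= c ->
  choquet phi f = fine (level_integral phi (fun y => f y + c)) - c * phi setT.
Proof.
move=> mf fc c0; rewrite /choquet /choquet_incr.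
have fle y : f y <= c by rewrite (le_trans (ler_norm _)).
(* A further shift by [a] adds [a * phi setT] to the level integral, so the normalised value does
   not depend on the shift. *)
have shift (h : J -> R) (a : R) : measurable_fun setT h ->
    (forall y, 0 <= h y <= c + c) -> 0 <= a ->
    fine (level_integral phi (fun y => h y + a)) - a * phi setT =
    fine (level_integral phi h).
  move=> mh hc a0.
  have fV : level_integral phi h \is a fin_num.
    apply: (level_integral_fin_num (C := c + c) phi_ge0 phi0 phi_ucont phi_leK) => //.
      exact: addr_ge0.
    by move=> y; have /andP[] := hc y.
  rewrite (level_integralD_cst phi_ge0 phi_ucont)//; last first.
    by move=> y; have /andP[] := hc y.
  move: (fineK fV); set r := fine (level_integral phi h) => <-.
  by rewrite -EFinD /=; ring.
case: asboolP => [f0|nf0].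
  rewrite (choquet_ge0B mf c0 fle) shift// => y.
  by rewrite f0 (le_trans (fle y))// lerDl.
set s := supnorm f.
(* A function that is not nonnegative has a point in its domain, so [supnorm f] is the supremum of a
   nonempty set. *)
have [y0 _] : exists y : J, True.
  by apply: contrapT => h; apply: nf0 => y; exfalso; apply: h; exists y.
have fs y : `|f y| <= s.
  apply: ub_le_sup; last by exists y.
  by exists c => _ [z _ <-].
have sc : s <= c.
  by apply: ge_sup; [exists `|f y0|, y0|move=> _ [z _ <-]].
have s0 : 0 <= s by rewrite (le_trans _ (fs y0)).
have mfs : measurable_fun setT (fun y => f y + s) by exact: measurable_funD.
have bfs y : 0 <= f y + s <= c + c.
  have := fs y; rewrite ler_norml => /andP[h _].
  by rewrite -lerBlDr sub0r h lerD.
have -> : (fun y => f y + c) = (fun y => f y + s + (c - s)).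
  by apply/funext => y; lra.
have cE := @choquet_ge0B _ (c + c) mfs (addr_ge0 c0 c0)
  (fun y => proj2 (andP (bfs y))).
have vE := variationB phi_submod phi0 phi_leK phi_ge0 measurableT.
have := shift _ (c - s) mfs bfs; rewrite subr_ge0 => /(_ sc).
rewrite -cE -vE; set v := fine _; set p := pos_variation _ _.
set n := neg_variation _ _; set cp := choquet_ge0 _ _; set cn := choquet_ge0 _ _.
move=> h; have -> : v = cp - cn + (c - s) * (p - n) by rewrite -h subrK.
by ring.
Qed.

End level_integral_theory.

(** * Mixtures of sets *)

Section level_integral_mixture.
Context {R : realType} {dZ d : measure_display}.
Context {Z : measurableType dZ} {J : measurableType d}.
Variables (nu : {sigma_finite_measure set Z -> \bar R}).
Variables (P : probability J R) (phi : set J -> R).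
Hypothesis phi_ge0 : forall X : set J, measurable X -> 0 <= phi X.
Hypothesis phi_submod : submodular phi.
Hypothesis phi0 : phi set0 = 0.
Hypothesis phi_ucont : unif_continuous_wrt P phi.
Variables (E : set (Z * J)) (D : set Z).
Hypothesis mE : measurable E.
Hypothesis mD : measurable D.
Hypothesis D_fin : (nu D < +oo)%E.
Hypothesis E_D : E `<=` D `*` setT.

(** The integral over [z] of the indicator of [xsection E z] at [y]. *)
Let mix (y : J) : R := fine (nu (ysection E y)).

Let C : R := fine (nu D).

Let CE : nu D = C%:E.
Proof. by rewrite /C fineK// ge0_fin_numE. Qed.

Let C0 : 0 <= C. Proof. by rewrite /C fine_ge0. Qed.

Let finD A : measurable A -> A `<=` D -> (nu A < +oo)%E.
Proof.
by move=> mA AD; apply: le_lt_trans D_fin; apply: le_measure; rewrite ?inE.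
Qed.

Let ysection_D y : ysection E y `<=` D.
Proof. by rewrite ysectionE => z /= /E_D[]. Qed.

Let mmix : measurable_fun setT mix.
Proof.
apply: measurableT_comp; first exact: fine_measurable.
exact: measurable_fun_ysection.
Qed.

Let mix_leC y : mix y <= C.
Proof.
have my : measurable (ysection E y) by exact: measurable_ysection.
rewrite /mix /C fine_le// ?ge0_fin_numE//; first exact: finD.
by apply: le_measure; rewrite ?inE.
Qed.

Let mphi : measurable_fun setT (fun z => (phi (xsection E z))%:E).
Proof. exact/measurable_EFinP/(measurable_fun_setfun_xsection phi_ucont). Qed.

Let mxE z : measurable (xsection E z). Proof. exact: measurable_xsection. Qed.

Section approximation.
Variables (B : nat -> set J) (eta eps : R).
Hypothesis mB : forall i, measurable (B i).
Hypothesis eta0 : 0 < eta.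
Hypothesis eps0 : 0 < eps.
Hypothesis B_dense : forall z, exists i, (P (xsection E z `+` B i) < eta%:E)%E.
Hypothesis eta_eps : forall S T, measurable S -> measurable T ->
    (P (S `+` T) < eta%:E)%E -> `|phi S - phi T| < eps.

(** The disjoint sets [W i] cover [D]: [W i] keeps the [z] for which [B i] is the first member
    within [eta] of the section at [z]. Their measures are the weights of the simple
    approximation. *)
Let U i : set Z := D `&` [set z | (P (xsection E z `+` B i) < eta%:E)%E].
Let W := seqDU U.
Let w i : R := fine (nu (W i)).

Let mU i : measurable (U i).
Proof.
apply: emeasurable_fun_infty_o => //; apply: measurable_funTS.
exact: measurable_fun_xsection_setY.
Qed.

Let mW i : measurable (W i). Proof. exact: seqDU_measurable. Qed.
Let W_U i : W i `<=` U i. Proof. exact: subset_seqDU. Qed.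
Let W_D i : W i `<=` D. Proof. by move=> z /W_U[]. Qed.
Let tW : trivIset setT W. Proof. exact: trivIset_seqDU. Qed.
Let w0 i : 0 <= w i. Proof. by rewrite fine_ge0. Qed.

Let nuW i : nu (W i) = (w i)%:E.
Proof. by rewrite /w fineK// ge0_fin_numE// finD. Qed.

Let UD : \bigcup_i U i = D.
Proof.
apply/seteqP; split => [z [i _ []]//|z Dz].
by have [i hi] := B_dense z; exists i.
Qed.

(** On [W i], [phi (B i)] is below [phi (xsection E z) + eps]; integrate over the disjoint [W i],
    all inside [D]. *)
Let sum_weights_le n :
  ((\sum_(i < n) w i * phi (B i))%:E <=
   \int[nu]_z (phi (xsection E z))%:E + (eps * C)%:E)%E.
Proof.
have pE z : (0 <= (phi (xsection E z))%:E)%E by rewrite lee_fin phi_ge0.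
have mpe A : measurable_fun A (fun z => (phi (xsection E z))%:E + eps%:E)%E.
  apply: emeasurable_funD => //; exact: measurable_funTS.
apply: (@le_trans _ _ (\int[nu]_(z in D) ((phi (xsection E z))%:E + eps%:E))%E);
  last first.
  rewrite ge0_integralD//; last by move=> z _; rewrite lee_fin ltW.
    by apply: leeD; [exact: ge0_subset_integral|
      rewrite integral_cst// [X in (_ * X)%E]CE].
  exact: measurable_funTS.
apply: (@le_trans _ _ (\int[nu]_(z in \big[setU/set0]_(i <- iota 0 n) W i)
    ((phi (xsection E z))%:E + eps%:E))%E); last first.
  apply: ge0_subset_integral => //.
  - exact: bigsetU_measurable.
  - by move=> z _; rewrite adde_ge0// lee_fin ltW.
  - by rewrite -bigcup_seq; apply: bigcup_sub => i _; exact: W_D.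
rewrite ge0_integral_bigsetU//; last 3 first.
- exact: iota_uniq.
- exact: sub_trivIset tW.
- by move=> z _; rewrite adde_ge0// lee_fin ltW.
rewrite -(big_mkord xpredT (fun i => w i * phi (B i))) /index_iota subn0 -sumEFin.
apply: lee_sum => i _.
apply: (@le_trans _ _ (\int[nu]_(z in W i) (phi (B i))%:E)%E).
  by rewrite integral_cst// [X in (_ * X)%E]nuW -EFinM mulrC.
apply: ge0_le_integral => //.
- by move=> z _; rewrite lee_fin phi_ge0.
- move=> z /W_U[_ /= /(eta_eps (mxE z) (mB i))].
  by rewrite ltr_distl -EFinD lee_fin => /andP[h _]; rewrite -lerBlDr ltW.
Qed.

Let mixn n (y : J) : R := \sum_(i < n) w i * \1_(B i) y.

(** Its section is [B i] over [W i] for [i < n] and empty elsewhere, so [mixn n] is to [E' n] what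
    [mix] is to [E]. *)
Let E' n : set (Z * J) := \big[setU/set0]_(i < n) (W i `*` B i).

Let mE' n : measurable (E' n).
Proof. by apply: bigsetU_measurable => i _; exact: measurableX. Qed.

Let E'P n z y : E' n (z, y) <-> exists i, [/\ (i < n)%N, W i z & B i y].
Proof.
rewrite /E' -(bigcup_mkord n (fun i => W i `*` B i)); split.
  by move=> [i /= ? []]; exists i.
by move=> [i [? ? ?]]; exists i.
Qed.

Let mixnE n y : nu (ysection (E' n) y) = (mixn n y)%:E.
Proof.
have -> : ysection (E' n) y =
    \big[setU/set0]_(i < n) (W i `&` [set _ | B i y]).
  rewrite -(bigcup_mkord n (fun i => W i `&` [set _ | B i y])) ysectionE.
  apply/seteqP; split => z /=.
    by move=> /E'P[i [? ? ?]]; exists i.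
  by move=> [i /= ? [? ?]]; apply/E'P; exists i.
have WB i : W i `&` [set _ | B i y] = if y \in B i then W i else set0.
  case: ifPn => [/set_mem By|/negP By]; apply/seteqP; split => z //=.
  - by case.
  - by move=> [_ /mem_set].
have mWB i : measurable (W i `&` [set _ | B i y]) by rewrite WB; case: ifPn.
have -> := @measure_semi_additive_ord_I _ _ _ nu
  (fun i => W i `&` [set _ | B i y]) n (fun i _ => mWB i).
- rewrite /mixn -sumEFin; apply: eq_bigr => i _; rewrite WB indicE.
  by case: ifPn => _; rewrite ?mulr1 ?mulr0; [exact: nuW|exact: measure0].
- by apply: trivIset_setIr; exact: sub_trivIset tW.
- exact: bigsetU_measurable.
Qed.

(** The integrand is at most the measure of the [y]-section of [E + E' n]. After exchanging
    integrals, the [z]-sections have measure at most [eta] on the chosen [W i], at most 1 on the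
    leftover [T], and 0 off [D]. *)
Let integral_mixB_le n (tau : R) :
  (nu (D `\` \big[setU/set0]_(i < n) U i) < tau%:E)%E ->
  (\int[P]_y `|mix y - mixn n y|%:E <= (eta * C + tau)%:E)%E.
Proof.
move=> htau; set T := D `\` _ in htau.
have mT : measurable T by apply: measurableD => //; exact: bigsetU_measurable.
have mA : measurable (E `+` E' n) by exact: measurable_setY.
have mmixn : measurable_fun setT (mixn n).
  by apply: measurable_sum => i; exact: measurable_funM.
apply: (@le_trans _ _ (\int[P]_y nu (ysection (E `+` E' n) y))%E).
  apply: ge0_le_integral => //.
  - apply/measurable_EFinP; apply: measurableT_comp => //.
    exact: measurable_funB.
  - exact: measurable_fun_ysection.
  move=> y _; have lt_E' : (nu (ysection (E' n) y) < +oo)%E by rewrite mixnE ltry.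
  rewrite (_ : mixn n y = fine (nu (ysection (E' n) y))); last first.
    by rewrite mixnE.
  apply: le_trans (distr_measure_le _ _ _ _) _.
  - exact: measurable_ysection.
  - exact: measurable_ysection.
  - by apply: finD => //; exact: measurable_ysection.
  - exact: lt_E'.
  by rewrite !setY_def !ysectionE.
have := indic_fubini_tonelli nu P mA.
rewrite indic_fubini_tonelli_FE// indic_fubini_tonelli_GE//= => <-.
have eta0' : (0 <= eta%:E)%E by rewrite lee_fin ltW.
apply: (@le_trans _ _ (\int[nu]_z (eta%:E * (\1_D z)%:E + (\1_T z)%:E))%E).
  apply: ge0_le_integral => //.
  - exact: measurable_fun_xsection.
  - apply: emeasurable_funD; last exact/measurable_EFinP.
    by apply: measurable_funeM; exact/measurable_EFinP.
  move=> z _ /=.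
  have [Dz|nDz] := pselect (D z); last first.
    rewrite (_ : xsection _ z = set0) ?measure0 ?adde_ge0 ?mule_ge0 ?lee_fin//.
    rewrite -subset0 xsectionE setY_def => y /= [[/E_D[]//]|[/E'P[i [_ /W_D]]//]].
  have [Tz|nTz] := pselect (T z).
    rewrite !indicE !mem_set// mule1.
    apply: (@le_trans _ _ 1%E); last by rewrite leeDr.
    by apply: probability_le1; exact: measurable_xsection.
  have [i iN Wz] : exists2 i, (i < n)%N & W i z.
    apply: contrapT => h; apply: nTz; split => //.
    rewrite bigsetU_seqDU -bigcup_mkord => -[i /= iN Wz].
    by apply: h; exists i.
  rewrite (_ : xsection (E `+` E' n) z = xsection E z `+` B i).
    rewrite indicE mem_set// mule1 -[leLHS]adde0; apply: leeD; rewrite ?lee_fin//.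
    by have [_ /ltW] := W_U Wz.
  rewrite !xsectionE !setY_def.
  suff BE : (pair z) @^-1` E' n = B i.
    by rewrite -BE; apply/seteqP; split.
  apply/seteqP; split => y /=.
    move=> /E'P[j [jn Wjz Bj]].
    by rewrite -(tW (i := j) (j := i))//; exists z.
  by move=> By; apply/E'P; exists i.
rewrite ge0_integralD//; last 3 first.
- by move=> z _; rewrite mule_ge0// lee_fin.
- by apply: measurable_funeM; exact/measurable_EFinP.
- exact/measurable_EFinP.
rewrite ge0_integralZl//; last exact/measurable_EFinP.
rewrite !integral_indic// !setIT EFinD EFinM; apply: leeD; last exact: ltW.
by rewrite [X in (_ * X)%E]CE.
Qed.

(** [eps * C] is paid twice, for passing from [mix] to [mixn n] and for replacing sections by the
    [B i]; the last term comes from the mean distance between [mix] and [mixn n]. *)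
Lemma level_integral_mixture_approx (K delta : R) :
  (forall S, measurable S -> phi S <= K) -> 0 < delta ->
  (forall S T, measurable S -> measurable T ->
    (P (S `+` T) < delta%:E)%E -> `|phi S - phi T| < eps) ->
  (level_integral phi mix <= \int[nu]_z (phi (xsection E z))%:E +
   (2 * eps * C + K / delta * (eta * (C + 1)))%:E)%E.
Proof.
move=> phi_leK delta0 hdelta.
have K0 : 0 <= K by rewrite (le_trans (phi_ge0 measurable0))// phi_leK.
(* The leftover of [D] is made smaller than [eta] as well, whence the factor [C + 1]. *)
have [n hn] : exists n, (nu (D `\` \big[setU/set0]_(i < n) U i) < eta%:E)%E.
  have := measure_bigcup_tail_lt (m := nu) (X := U) mU; rewrite UD; exact.
have mmixn : measurable_fun setT (mixn n).
  by apply: measurable_sum => i; exact: measurable_funM.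
have := level_integral_continuity phi_ge0 phi0 phi_ucont phi_leK
  mmix mmixn mix_leC C0 eps0 delta0 hdelta.
move=> /le_trans; apply.
have -> : 2 * eps * C + K / delta * (eta * (C + 1)) =
   eps * C + eps * C + K / delta * (eta * C + eta) by ring.
rewrite !EFinD !addeA; apply: leeD.
  apply: leeD => //; apply: le_trans (sum_weights_le n).
  exact: (level_integral_simple_le phi_ge0 phi_submod phi0 phi_ucont phi_leK).
rewrite [leRHS]EFinM; apply: lee_wpmul2l; first by rewrite lee_fin divr_ge0// ltW.
exact: integral_mixB_le.
Qed.

End approximation.

Lemma level_integral_mixture_le :
  (level_integral phi (fun y => fine (nu (ysection E y)))
   <= \int[nu]_z (phi (xsection E z))%:E)%E.
Proof.
have [K phi_leK] := unif_continuous_bounded phi_ge0 phi_submod phi0 phi_ucont.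
have K0 : 0 <= K by rewrite (le_trans (phi_ge0 measurable0))// phi_leK.
have [B mB hB] := measurable_separable_sections P mE.
apply/lee_addgt0Pr => e e0.
have C1 : 0 < C + 1 by rewrite ltr_wpDl.
have K1 : 0 < K + 1 by rewrite ltr_wpDl.
(* [eps] and [eta] make each error term at most [e / 2]; [C + 1] and [K + 1] avoid division by zero.
   The minimum with [delta] lets [eta] inherit the modulus of [eps]. *)
pose eps := e / 2 / (2 * (C + 1)).
have eps0 : 0 < eps by rewrite !divr_gt0// mulr_gt0.
have [delta delta0 hdelta] := phi_ucont eps0.
pose eta := Num.min delta (e / 2 * delta / ((K + 1) * (C + 1))).
have eta0 : 0 < eta by rewrite lt_min delta0/= divr_gt0// mulr_gt0// divr_gt0.
have eta_eps S T : measurable S -> measurable T ->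
    (P (S `+` T) < eta%:E)%E -> `|phi S - phi T| < eps.
  move=> mS mT /lt_le_trans h; apply: hdelta => //; apply: h.
  by rewrite lee_fin ge_min lexx.
have hB' z : exists i, (P (xsection E z `+` B i) < eta%:E)%E by exact: hB.
have := level_integral_mixture_approx mB eta0 eps0 hB' eta_eps phi_leK delta0 hdelta.
move=> /le_trans; apply; rewrite leeD2l// lee_fin [leRHS]splitr lerD//.
  have -> : 2 * eps * C = e / 2 * (C / (C + 1)).
    by rewrite /eps; field; rewrite gt_eqF.
  by rewrite ger_pMr ?divr_gt0// ler_pdivrMr// mul1r lerDl.
apply: (@le_trans _ _ (K / delta *
    (e / 2 * delta / ((K + 1) * (C + 1)) * (C + 1)))).
  apply: ler_wpM2l; first by rewrite divr_ge0// ltW.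
  by apply: ler_wpM2r; [exact: ltW|rewrite ge_min lexx orbT].
have -> : K / delta * (e / 2 * delta / ((K + 1) * (C + 1)) * (C + 1)) =
    e / 2 * (K / (K + 1)).
  by field; rewrite !gt_eqF.
by rewrite ger_pMr ?divr_gt0// ler_pdivrMr// mul1r lerDl.
Qed.

End level_integral_mixture.

(** * The hypograph of a bounded function as a family of sets *)

Section hypograph.
Context {R : realType} {dI dJ : measure_display}.
Context {I : measurableType dI} {J : measurableType dJ}.
Variables (lam : probability I R) (G : I * J -> R) (b : R).
Hypothesis mG : measurable_fun setT G.
Hypothesis b_ge0 : 0 <= b.
Hypothesis G_ge0_leb : forall z, 0 <= G z <= b.
Local Notation mu := (@lebesgue_measure R).

(** The pair [(x, t)] is grouped as the index: for [t >= 0] its section is the superlevel set of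
    [G (x, _)] at [t], and for [t < 0] it is empty. *)
Definition hypograph : set ((I * measurableTypeR R) * J) :=
  [set z | 0 <= z.1.2] `&` [set z | z.1.2 <= G (z.1.1, z.2)].

(** A set of finite measure off which all sections are empty, although the measure on [I * R] is
    infinite. *)
Definition hypograph_domain : set (I * measurableTypeR R) :=
  setT `*` (`[0, b]%classic : set R).

Lemma measurable_hypograph : measurable hypograph.
Proof.
have mt : measurable_fun setT
    (fun z : (I * measurableTypeR R) * J => z.1.2 : R).
  exact: (measurableT_comp measurable_snd measurable_fst).
apply: measurableI.
  by rewrite -[X in measurable X]setTI; apply: measurable_fun_le.
rewrite -[X in measurable X]setTI; apply: measurable_fun_le => //.
apply: (measurableT_comp mG); apply: measurable_fun_pair => //.
exact: (measurableT_comp measurable_fst measurable_fst).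
Qed.

Lemma measurable_hypograph_domain : measurable hypograph_domain.
Proof. exact: measurableX. Qed.

Lemma hypograph_sub : hypograph `<=` hypograph_domain `*` setT.
Proof.
move=> [[x t] y] [/= t0 tG]; split => //; split => //=.
have /andP[_] := G_ge0_leb (x, y); rewrite in_itv/= t0; exact: le_trans.
Qed.

(* A copy of the product measure carrying the sigma-finite structure, which is
   not inferred for [\x] when one of the factors is infinite. *)
Definition lebesgue_product : set (I * measurableTypeR R) -> \bar R :=
  (lam \x mu)%E.

HB.instance Definition _ := Measure.on lebesgue_product.

Let lebesgue_product_sigma_finite : sigma_finite setT lebesgue_product.
Proof.
have [A AT hA] := sigma_finiteT mu.
exists (fun n => setT `*` A n); first by rewrite -setX_bigcupr -AT setXTT.
move=> n; have [mA Aoo] := hA n; split; first exact: measurableX.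
by rewrite /lebesgue_product product_measure1E//= probability_setT mul1e.
Qed.

HB.instance Definition _ := Measure_isSigmaFinite.Build _ _ _ lebesgue_product
  lebesgue_product_sigma_finite.

Lemma product_measure_hypograph_domain :
  (lebesgue_product hypograph_domain <= b%:E)%E.
Proof.
rewrite /lebesgue_product /hypograph_domain product_measure1E//=.
rewrite probability_setT mul1e lebesgue_measure_itv/= lte_fin.
by case: ifPn => [_|_]; rewrite -?EFinB ?subr0 lee_fin.
Qed.

(** The fibre over [x] is the interval [[0, G (x, y)]]. So the mixture of the sections is the
    average of [G]. *)
Lemma product_measure_ysection_hypograph (y : J) :
  lebesgue_product (ysection hypograph y) = (\int[lam]_x (G (x, y))%:E)%E.
Proof.
rewrite /lebesgue_product /product_measure1/=; apply: eq_integral => x _ /=.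
rewrite (_ : xsection _ x = `[0, G (x, y)]%classic); last first.
  rewrite xsectionE ysectionE; apply/seteqP; split => t /=; rewrite in_itv/=.
    by move=> [-> ->].
  by move=> /andP[].
rewrite lebesgue_measure_itv/= lte_fin.
have /andP[G0 _] := G_ge0_leb (x, y).
case: ifPn => [_|]; first by rewrite -EFinB subr0.
by rewrite -leNgt => G0'; congr EFin; apply/eqP; rewrite eq_le G0.
Qed.

(** Negative levels contribute [psi set0 = 0]. *)
Lemma integral_setfun_hypograph (psi : set J -> R) (x : I) : psi set0 = 0 ->
  (\int[mu]_t (psi (xsection hypograph (x, t)))%:E =
   level_integral psi (fun y => G (x, y)))%E.
Proof.
move=> psi0; rewrite /level_integral [RHS]integral_mkcond.
apply: eq_integral => t _; rewrite patchE xsectionE.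
have [t0|t0] := leP 0 t.
  rewrite mem_set/= ?in_itv/= ?t0//.
  by congr (psi _)%:E; apply/seteqP; split => y //= [].
rewrite memNset/= ?in_itv/= ?andbT; last by apply/negP; rewrite -ltNge.
rewrite (_ : _ @^-1` _ = set0) ?psi0// -subset0 => y /= [/= t0' _].
by move: t0; rewrite ltNge t0'.
Qed.

End hypograph.

(** * The Choquet extension at an average *)

Theorem theorem4p1 (R : realType) (dI dJ : measure_display)
  (I : measurableType dI) (J : measurableType dJ)
  (lam : probability I R) (P : probability J R)
  (phi : set J -> R)
  (phi_ge0 : forall X : set J, measurable X -> 0 <= phi X)
  (phi_submod : submodular phi)
  (phi0 : phi set0 = 0)
  (phi_ucont : unif_continuous_wrt P phi)
  (F : I * J -> R)
  (F_meas : measurable_fun setT F)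
  (F_bounded : exists M : R, forall z : I * J, `|F z| <= M) :
  lam.-integrable setT (fun x : I => (choquet phi (fun y : J => F (x, y)))%:E) /\
  choquet phi (fun y : J => \int[lam]_x F (x, y))
    <= \int[lam]_x choquet phi (fun y : J => F (x, y)).
Proof.
have [M hM] := F_bounded.
have [K phi_leK] := unif_continuous_bounded phi_ge0 phi_submod phi0 phi_ucont.
pose c := `|M|; have c0 : 0 <= c by exact: normr_ge0.
have Fc z : `|F z| <= c by rewrite (le_trans (hM z))// ler_norm.
pose G z := F z + c.
have mG : measurable_fun setT G by exact: measurable_funD.
have Gc z : 0 <= G z <= c + c.
  have := Fc z; rewrite ler_norml /G => /andP[? ?].
  by rewrite -lerBlDr sub0r lerD2r; apply/andP.
have cc0 : 0 <= c + c by exact: addr_ge0.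
have mFx x : measurable_fun setT (fun y => F (x, y)) by exact: measurable_fun_pair2.
have mGx x : measurable_fun setT (fun y => G (x, y)) by exact: measurable_fun_pair2.
have mFy y : measurable_fun setT (fun x => F (x, y)) by exact: measurable_fun_pair1.
pose nu : {sigma_finite_measure set (I * measurableTypeR R)%type -> \bar R} :=
  lebesgue_product lam.
have mE : measurable (hypograph G) by exact: measurable_hypograph.
have mD : measurable (hypograph_domain (I := I) (c + c)).
  exact: measurable_hypograph_domain.
have Doo : (nu (hypograph_domain (I := I) (c + c)) < +oo)%E.
  exact: le_lt_trans (product_measure_hypograph_domain lam cc0) (ltry _).
(* The left side is the level integral of the averaged [G]; Tonelli will turn the right side into
   the integral of [V] below. *)
have main := level_integral_mixture_le (nu := nu) phi_ge0 phi_submod phi0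
  phi_ucont mE mD Doo (hypograph_sub Gc).
pose V x := level_integral phi (fun y => G (x, y)).
have mphiE : measurable_fun setT (fun z => (phi (xsection (hypograph G) z))%:E).
  exact/measurable_EFinP/(measurable_fun_setfun_xsection phi_ucont).
have pE z : (0 <= (phi (xsection (hypograph G) z))%:E)%E.
  by rewrite lee_fin phi_ge0//; exact: measurable_xsection.
have VE x : (\int[lebesgue_measure]_t
    (phi (xsection (hypograph G) (x, t)))%:E)%E = V x.
  exact: integral_setfun_hypograph.
have mV : measurable_fun setT V.
  rewrite (_ : V = fubini_F lebesgue_measure
    (fun z => (phi (xsection (hypograph G) z))%:E)).
    exact: measurable_fun_fubini_tonelli_F.
  by apply/funext => x; rewrite /fubini_F VE.
have V0 x : (0 <= V x)%E by exact: level_integral_ge0.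
have VK x : (V x <= (K * (c + c))%:E)%E.
  apply: (level_integral_le phi_ge0 phi0 phi_ucont phi_leK) => // y.
  by have /andP[] := Gc (x, y).
have fV x : V x \is a fin_num.
  by rewrite ge0_fin_numE// (le_lt_trans (VK x))// ltry.
(* The bound [c] is common to all [x], so the Choquet value differs from [V x] by a constant. *)
have choquetE x : choquet phi (fun y => F (x, y)) = fine (V x) - c * phi setT.
  exact: (choquet_level_integral phi_ge0 phi_submod phi0 phi_ucont phi_leK).
have mfV : measurable_fun setT (fun x => fine (V x)).
  by apply: measurableT_comp; first exact: fine_measurable.
have bdd (h : I -> R) (b : R) : measurable_fun setT h -> (forall x, `|h x| <= b) ->
    lam.-integrable setT (EFin \o h).
  move=> mh hb; apply: measurable_bounded_integrable => //.
    by rewrite [X in (X < _)%E]probability_setT ltry.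
  exists b; split; first exact: num_real.
  by move=> b' /ltW bb' x _; rewrite /= (le_trans (hb x)).
have iV : lam.-integrable setT (EFin \o fun x => fine (V x)).
  apply: (bdd _ (K * (c + c)) mfV) => x.
  by rewrite ger0_norm ?fine_ge0// -lee_fin fineK.
have icst (r : R) : lam.-integrable setT (EFin \o fun=> r).
  by apply: (bdd _ `|r|).
have iC : lam.-integrable setT (EFin \o fun x => choquet phi (fun y => F (x, y))).
  rewrite (_ : _ \o _ = ((EFin \o fun x => fine (V x)) \-
      (EFin \o fun=> (c * phi setT)%R))%E); first exact: integrableB.
  by apply/funext => x /=; rewrite choquetE.
split; first exact: iC.
have mixE y : fine (nu (ysection (hypograph G) y)) = \int[lam]_x F (x, y) + c.
  transitivity (\int[lam]_x G (x, y)).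
    congr fine; exact: product_measure_ysection_hypograph.
  rewrite RintegralD//; last exact: (bdd _ c).
  by rewrite Rintegral_cst// [X in _ * fine X]probability_setT mulr1.
pose g y := \int[lam]_x F (x, y).
have gE y : g y = fine (nu (ysection (hypograph G) y)) - c by rewrite mixE addrK.
have mg : measurable_fun setT g.
  rewrite (_ : g = fun y => fine (nu (ysection (hypograph G) y)) - c);
    last exact/funext.
  apply: measurable_funB => //; apply: measurableT_comp; first exact: fine_measurable.
  exact: measurable_fun_ysection.
(* [g y + c] is the measure of a section inside the domain, hence lies between 0 and [c + c]. *)
have gc y : `|g y| <= c.
  rewrite ler_norml gE lerBlDr lerBrDr addNr fine_ge0//=.
  rewrite -lee_fin fineK; last first.
    rewrite ge0_fin_numE//; apply: le_lt_trans Doo.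
    apply: le_measure; rewrite ?inE//; first exact: measurable_ysection.
    by rewrite ysectionE => z /= /(hypograph_sub Gc)[].
  apply: le_trans (product_measure_hypograph_domain lam cc0).
  apply: le_measure; rewrite ?inE//; first exact: measurable_ysection.
  by rewrite ysectionE => z /= /(hypograph_sub Gc)[].
(* Both sides now carry the same constant [c * phi setT]; cancelling it leaves [main]. *)
rewrite (choquet_level_integral phi_ge0 phi_submod phi0 phi_ucont phi_leK mg gc c0).
under eq_Rintegral do rewrite choquetE.
rewrite RintegralB// Rintegral_cst// [X in _ * fine X]probability_setT mulr1 lerD2r.
rewrite /Rintegral; under [in leRHS]eq_integral do rewrite fineK//.
apply: fine_le.
- apply: (level_integral_fin_num (C := c + c) phi_ge0 phi0 phi_ucont phi_leK) => //.
    exact: measurable_funD.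
  by move=> y; rewrite lerD2r (le_trans (ler_norm _)).
- rewrite ge0_fin_numE; last by apply: integral_ge0.
  apply: (@le_lt_trans _ _ (\int[lam]_x (K * (c + c))%:E)%E).
    exact: ge0_le_integral.
  by rewrite integral_cst// [X in (_ * X)%E]probability_setT mule1 ltry.
under [X in level_integral _ X]funext do rewrite -mixE.
rewrite (le_trans main)// /nu fubini_tonelli1//.
by rewrite le_eqVlt (eq_integral V) ?eqxx// => x _; exact: VE.
Qed.
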